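(* Let $T>0$ and let $h\in C^\infty([0,T]\times\mathbf{T})$ be a smooth positive solution to the Boussinesq equation in space dimension $1$, $$\partial_th-\partial_x(h\,\partial_xh)=0 .$$ Then, for all $t\in[0,T]$, $$\frac{d}{dt}\int_{\mathbf{T}}(\partial_xh)\arctan(\partial_xh)\,dx\le0 .$$
   Context: $\mathbf{T}$ is the one-dimensional torus (circle). *)

(* Defs.v *)
From Stdlib Require Import Reals.
From Coquelicot Require Import Coquelicot.
Open Scope R_scope.

(* Coquelicot's [is_derive] with [locally x] replaced by its trace on [D]:
   the derivative of [f] at [x] along points of [D]. For [D = [0,T]] it is
   one-sided at the two endpoints. *)
Definition is_derive_on (D : R -> Prop) (f : R -> R) (x l : R) : Prop :=
  filterdiff f (within D (locally x)) (fun y : R => scal y l).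

Definition Icc (a b : R) : R -> Prop := fun t => a <= t <= b.

(* A function on [0,T] x R/(2 PI Z) is a map [f : R -> R -> R], time first, that is
   2*PI-periodic in space; its values at times outside [0,T] are irrelevant.
   [Ck_strip T n f]: all partial derivatives of [f] of order at most [n] exist
   and are jointly continuous on the closed strip [0,T] x R. *)
Fixpoint Ck_strip (T : R) (n : nat) (f : R -> R -> R) : Prop :=
  continuous_on (fun p : R * R => Icc 0 T (fst p))
                (fun p : R * R => f (fst p) (snd p)) /\
  match n with
  | O => True
  | S m =>
      exists ft fx : R -> R -> R,
        (forall t x, Icc 0 T t ->
           is_derive_on (Icc 0 T) (fun s => f s x) t (ft t x)) /\
        (forall t x, Icc 0 T t -> is_derive (fun y => f t y) x (fx t x)) /\
        Ck_strip T m ft /\ Ck_strip T m fx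
  end.

Definition smooth_on_torus (T : R) (f : R -> R -> R) : Prop :=
  (forall t x, Icc 0 T t -> f t (x + 2 * PI) = f t x) /\
  (forall n, Ck_strip T n f).

Definition partial_x (f : R -> R -> R) (t x : R) : R := Derive (fun y => f t y) x.

Definition boussinesq_solution (T : R) (h : R -> R -> R) : Prop :=
  forall t x, Icc 0 T t ->
    exists ht : R,
      is_derive_on (Icc 0 T) (fun s => h s x) t ht /\
      ht - partial_x (fun s y => h s y * partial_x h s y) t x = 0.

(* Main.v *)
(* With u = h_x and v = h_t = (h h_x)_x = u^2 + h u_x, the functional int phi(u)
   has derivative int phi'(u) v_x for every C^2 function phi. If G is a
   primitive of w^2 phi''(w), then
     (phi'(u) v - G(u))_x = phi'(u) v_x + h phi''(u) u_x^2,
   and the left-hand side has mean zero by periodicity. Hence the functional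
   decreases at the rate int h phi''(u) u_x^2 when phi is convex, and
   phi(w) = w arctan w is convex since phi''(w) = 2 / (1 + w^2)^2. *)
Require Import Defs.
From Stdlib Require Import Reals Lra.
From Coquelicot Require Import Coquelicot.
Open Scope R_scope.

Lemma within_locally_proper {U : UniformSpace} (D : U -> Prop) (x : U) :
  D x -> ProperFilter (within D (locally x)).
Proof.
  intros Dx; split; [|apply within_filter, locally_filter].
  intros P HP. exists x. exact (locally_singleton x _ HP Dx).
Qed.

Lemma is_filter_lim_within_locally {U : UniformSpace} (D : U -> Prop) (x : U) :
  is_filter_lim (within D (locally x)) x.
Proof. intros P HP. exact (filter_le_within D P HP). Qed.

Lemma is_filter_lim_within_locally_eq (D : R -> Prop) (x y : R) : D x ->
  is_filter_lim (within D (locally x)) y -> y = x.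
Proof.
  intros Dx Hy. pose proof (within_locally_proper D x Dx) as proper.
  apply (is_filter_lim_unique (K := R_AbsRing) (V := R_NormedModule) _ _ Hy).
  apply is_filter_lim_within_locally.
Qed.

Lemma is_derive_on_eps_delta (D : R -> Prop) (f : R -> R) (x l : R) : D x ->
  is_derive_on D f x l <->
  forall eps : posreal, exists delta : posreal, forall y, D y ->
    Rabs (y - x) < delta ->
    Rabs (f y - f x - (y - x) * l) <= eps * Rabs (y - x).
Proof.
  intros Dx; split.
  - intros [_ H] eps.
    destruct (H x (is_filter_lim_within_locally D x) eps) as [d Hd].
    exists d. intros y Dy Hy. exact (Hd y Hy Dy).
  - intros H; split; [exact (is_linear_scal_l (V := R_NormedModule) l)|].
    intros z Hz eps. rewrite (is_filter_lim_within_locally_eq D x z Dx Hz).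
    destruct (H eps) as [d Hd]. exists d. intros y Hy Dy. exact (Hd y Dy Hy).
Qed.

Lemma is_derive_on_ext (D : R -> Prop) (f g : R -> R) (x l : R) : D x ->
  (forall y, D y -> f y = g y) -> is_derive_on D f x l -> is_derive_on D g x l.
Proof.
  intros Dx fg Hf.
  apply (filterdiff_ext_loc (F := within D (locally x)) f); [| |exact Hf].
  - exact (filter_forall (F := locally x) _ fg).
  - intros z Hz. rewrite (is_filter_lim_within_locally_eq D x z Dx Hz).
    now apply fg.
Qed.

Lemma is_derive_on_minus (D : R -> Prop) (f g : R -> R) (x l m : R) :
  is_derive_on D f x l -> is_derive_on D g x m ->
  is_derive_on D (fun y => f y - g y) x (l - m).
Proof.
  intros Hf Hg.
  apply (filterdiff_ext_lin _ (fun y : R => minus (scal y l) (scal y m))).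
  - exact (filterdiff_minus_fct f g _ _ Hf Hg).
  - intros y. unfold minus, plus, opp, scal; simpl. unfold mult; simpl. ring.
Qed.

Lemma is_derive_on_continuous (D : R -> Prop) (f : R -> R) (x l : R) :
  is_derive_on D f x l -> filterlim f (within D (locally x)) (locally (f x)).
Proof.
  intros Hf. apply (filterdiff_continuous_aux (K := R_AbsRing)
    (U := R_NormedModule) (V := R_NormedModule)).
  - eexists; exact Hf.
  - apply is_filter_lim_within_locally.
Qed.

Lemma is_derive_on_comp (D : R -> Prop) (g f : R -> R) (x l m : R) : D x ->
  is_derive g (f x) m -> is_derive_on D f x l ->
  is_derive_on D (fun y => g (f y)) x (l * m).
Proof.
  intros Dx Hg Hf. pose proof (within_locally_proper D x Dx) as proper.
  apply (filterdiff_ext_lin _ (fun y : R => scal (scal y l) m)).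
  - apply (filterdiff_comp (K := R_AbsRing) (U := R_NormedModule)
      (V := R_NormedModule) (W := R_NormedModule) f g _
      (fun y : R => scal y m) Hf).
    apply (filterdiff_locally (F := filtermap f (within D (locally x))) g
      (f x)); [|exact Hg].
    exact (is_derive_on_continuous D f x l Hf).
  - intros y. unfold scal; simpl. unfold mult; simpl. ring.
Qed.

Lemma is_derive_on_locally (D : R -> Prop) (f : R -> R) (x l : R) :
  locally x D -> is_derive_on D f x l -> is_derive f x l.
Proof.
  intros HD [Hl H]. split; [exact Hl|]. intros z Hz eps.
  rewrite <- (is_filter_lim_locally_unique (K := R_AbsRing)
    (V := R_NormedModule) _ _ Hz).
  generalize (filter_and _ _ HD
    (H x (is_filter_lim_within_locally D x) eps)).
  apply filter_imp. intros y [Dy Hy]. exact (Hy Dy).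
Qed.

Lemma is_derive_on_D_in (D : R -> Prop) (f : R -> R) (x l : R) : D x ->
  is_derive_on D f x l -> D_in f (fun _ => l) D x.
Proof.
  intros Dx Hf eps Heps.
  destruct (proj1 (is_derive_on_eps_delta D f x l Dx) Hf
    (pos_div_2 (mkposreal _ Heps))) as [d Hd].
  exists d. split; [apply cond_pos|]. intros y [[Dy xy] Hy].
  specialize (Hd y Dy Hy). simpl in *. unfold Rdist.
  assert (yx : 0 < Rabs (y - x)) by (apply Rabs_pos_lt; lra).
  replace ((f y - f x) / (y - x) - l) with ((f y - f x - (y - x) * l) / (y - x))
    by (field; lra).
  unfold Rdiv at 1. rewrite Rabs_mult, Rabs_inv.
  apply Rlt_div_l; [exact yx|].
  apply (Rle_lt_trans _ _ _ Hd), Rmult_lt_compat_r; lra.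
Qed.

Lemma is_derive_on_unique (D : R -> Prop) (f : R -> R) (x l m : R) : D x ->
  adhDa (D_x D x) x -> is_derive_on D f x l -> is_derive_on D f x m -> l = m.
Proof.
  intros Dx Hx Hl Hm.
  apply (single_limit (fun y => (f y - f x) / (y - x)) (D_x D x) l m x Hx).
  - now apply is_derive_on_D_in.
  - now apply is_derive_on_D_in.
Qed.

Lemma Icc_locally (a b x : R) : a < x < b -> locally x (Icc a b).
Proof.
  intros Hx. apply (filter_imp (fun y => a < y /\ y < b)).
  - intros y; unfold Icc; lra.
  - apply filter_and; [apply open_gt | apply open_lt]; lra.
Qed.

Lemma Icc_adhDa (a b x : R) : a < b -> Icc a b x -> adhDa (D_x (Icc a b) x) x.
Proof.
  intros ab Dx eps Heps. unfold Icc, D_x, Rdist in *.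
  destruct (Rlt_dec x b) as [xb|xb].
  - assert (step_pos : 0 < Rmin (b - x) (eps / 2)) by (apply Rmin_glb_lt; lra).
    pose proof (Rmin_l (b - x) (eps / 2)).
    pose proof (Rmin_r (b - x) (eps / 2)).
    exists (x + Rmin (b - x) (eps / 2)). rewrite Rabs_right; lra.
  - assert (step_pos : 0 < Rmin (x - a) (eps / 2)) by (apply Rmin_glb_lt; lra).
    pose proof (Rmin_l (x - a) (eps / 2)).
    pose proof (Rmin_r (x - a) (eps / 2)).
    exists (x - Rmin (x - a) (eps / 2)). rewrite Rabs_left; lra.
Qed.

(* [MVT_gen] and [uniform_continuity_2d_1d'] ask for two-sided continuity, also
   at the endpoints of the time interval; composing with [clamp] provides it. *)
Definition clamp (a b t : R) : R := Rmax a (Rmin b t).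

Lemma clamp_Icc (a b t : R) : a <= b -> Icc a b (clamp a b t).
Proof. intros; unfold clamp, Icc, Rmax, Rmin; repeat destruct Rle_dec; lra. Qed.

Lemma clamp_id (a b t : R) : Icc a b t -> clamp a b t = t.
Proof. unfold clamp, Icc, Rmax, Rmin; repeat destruct Rle_dec; lra. Qed.

Lemma clamp_lipschitz (a b s t : R) :
  Rabs (clamp a b s - clamp a b t) <= Rabs (s - t).
Proof.
  unfold clamp, Rmax, Rmin; repeat destruct Rle_dec;
    unfold Rabs; repeat destruct Rcase_abs; lra.
Qed.

Lemma continuous_clamp (a b t : R) : continuous (clamp a b) t.
Proof.
  apply continuity_pt_filterlim, continuity_pt_locally. intros eps.
  exists eps. intros s Hs.
  exact (Rle_lt_trans _ _ _ (clamp_lipschitz a b s t) Hs).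
Qed.

Lemma continuous_pair {U V W : UniformSpace} (f : U -> V) (g : U -> W) (x : U) :
  continuous f x -> continuous g x -> continuous (fun y => (f y, g y)) x.
Proof.
  intros Hf Hg. apply (continuous_comp_2 f g pair); [exact Hf|exact Hg|].
  intros P HP. apply (filter_imp (F := locally (f x, g x)) P); [|exact HP].
  now intros [y z].
Qed.

Lemma continuous_on_comp {U V W : UniformSpace} (D : V -> Prop) (f : U -> V)
    (g : V -> W) (x : U) :
  (forall y, D (f y)) -> continuous f x -> continuous_on D g ->
  continuous (fun y => g (f y)) x.
Proof.
  intros fD Hf Hg.
  apply (filterlim_comp _ _ _ f g _ (within D (locally (f x)))).
  - intros P HP. unfold filtermap.
    apply (filter_imp (fun y => D (f y) -> P (f y))).
    + intros y Py. exact (Py (fD y)).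
    + exact (Hf _ HP).
  - exact (Hg (f x) (fD x)).
Qed.

Lemma is_derive_on_Icc_MVT (a b : R) (f df : R -> R) (s t : R) :
  (forall r, Icc a b r -> is_derive_on (Icc a b) f r (df r)) ->
  Icc a b s -> Icc a b t ->
  exists c, Rmin s t <= c <= Rmax s t /\ f t - f s = df c * (t - s).
Proof.
  intros Hf Ds Dt.
  destruct (MVT_gen (fun r => f (clamp a b r)) s t df) as [c [Hc mean_value]].
  - intros r Hr.
    assert (r_ab : a < r < b).
    { unfold Icc, Rmin, Rmax in *; destruct Rle_dec; lra. }
    apply (is_derive_ext_loc f).
    + apply (filter_imp (Icc a b)); [|now apply Icc_locally].
      intros y Hy. now rewrite clamp_id.
    + apply (is_derive_on_locally (Icc a b)); [now apply Icc_locally|].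
      apply Hf. unfold Icc; lra.
  - intros r _. apply continuity_pt_filterlim.
    apply (continuous_on_comp (Icc a b) (clamp a b) f).
    + intros y. apply clamp_Icc. unfold Icc in Ds; lra.
    + apply continuous_clamp.
    + intros y Dy. exact (is_derive_on_continuous _ _ _ _ (Hf y Dy)).
  - exists c. split; [exact Hc|]. now rewrite !clamp_id in mean_value.
Qed.

Definition jointly_continuous_on (D : R -> Prop) (f : R -> R -> R) : Prop :=
  continuous_on (fun p : R * R => D (fst p))
                (fun p : R * R => f (fst p) (snd p)).

Lemma jointly_continuous_on_comp (D : R -> Prop) (g : R -> R)
    (f : R -> R -> R) :
  (forall u, continuous g u) -> jointly_continuous_on D f ->
  jointly_continuous_on D (fun t x => g (f t x)).
Proof.
  intros Hg Hf p Dp.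
  exact (filterlim_comp _ _ _ _ g _ _ _ (Hf p Dp) (Hg (f (fst p) (snd p)))).
Qed.

Lemma jointly_continuous_on_mult (D : R -> Prop) (f g : R -> R -> R) :
  jointly_continuous_on D f -> jointly_continuous_on D g ->
  jointly_continuous_on D (fun t x => f t x * g t x).
Proof.
  intros Hf Hg p Dp.
  exact (filterlim_comp_2 _ _ Rmult (Hf p Dp) (Hg p Dp)
    (filterlim_mult (K := R_AbsRing) _ _)).
Qed.

Lemma jointly_continuous_on_section (D : R -> Prop) (f : R -> R -> R)
    (t x : R) :
  jointly_continuous_on D f -> D t -> continuous (f t) x.
Proof.
  intros Hf Dt.
  apply (continuous_on_comp (fun p : R * R => D (fst p)) (fun y => (t, y))
    (fun p : R * R => f (fst p) (snd p))); [now intros y| |exact Hf].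
  apply (continuous_pair (fun _ => t) (fun y => y)).
  - apply continuous_const.
  - apply continuous_id.
Qed.

Lemma jointly_continuous_on_clamp (a b : R) (f : R -> R -> R) (t x : R) :
  a <= b -> jointly_continuous_on (Icc a b) f ->
  continuity_2d_pt (fun s y => f (clamp a b s) y) t x.
Proof.
  intros ab Hf. apply continuity_2d_pt_filterlim.
  apply (continuous_on_comp (fun p : R * R => Icc a b (fst p))
    (fun p : R * R => (clamp a b (fst p), snd p))
    (fun p : R * R => f (fst p) (snd p))); [| |exact Hf].
  - intros p. now apply clamp_Icc.
  - apply (continuous_pair (fun p : R * R => clamp a b (fst p)) snd).
    + apply (continuous_comp fst); [apply continuous_fst|].
      apply continuous_clamp.
    + apply continuous_snd.
Qed.

Lemma is_derive_continuous (f : R -> R) (x l : R) :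
  is_derive f x l -> continuous f x.
Proof.
  intros Hf. apply (ex_derive_continuous (V := R_NormedModule)). now exists l.
Qed.

Lemma ex_RInt_everywhere_continuous (f : R -> R) (a b : R) :
  (forall x, continuous f x) -> ex_RInt f a b.
Proof.
  intros Hf. apply (ex_RInt_continuous (V := R_CompleteNormedModule)). auto.
Qed.

Lemma is_derive_RInt_everywhere_continuous (f : R -> R) (a x : R) :
  (forall y, continuous f y) -> is_derive (fun y => RInt f a y) x (f x).
Proof.
  intros Hf. apply (is_derive_RInt (V := R_NormedModule) f _ a); [|apply Hf].
  apply filter_forall. intros y.
  apply (RInt_correct (V := R_CompleteNormedModule)).
  now apply ex_RInt_everywhere_continuous.
Qed.

Definition is_partial_t_on (D : R -> Prop) (f ft : R -> R -> R) : Prop :=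
  forall t x, D t -> is_derive_on D (fun s => f s x) t (ft t x).

Lemma is_derive_on_Icc_uniform (a b c d : R) (f ft : R -> R -> R) (t : R) :
  is_partial_t_on (Icc a b) f ft -> jointly_continuous_on (Icc a b) ft ->
  Icc a b t ->
  forall eps : posreal, exists delta : posreal, forall s x, Icc a b s ->
    Rabs (s - t) < delta -> c <= x <= d ->
    Rabs (f s x - f t x - (s - t) * ft t x) <= eps * Rabs (s - t).
Proof.
  intros Hf Cft Dt eps.
  destruct (uniform_continuity_2d_1d' (fun s x => ft (clamp a b s) x) c d t)
    with (eps := eps) as [delta Hdelta].
  { intros x _. apply jointly_continuous_on_clamp; [|exact Cft].
    unfold Icc in Dt; lra. }
  exists delta. intros s x Ds Hs Hx.
  destruct (is_derive_on_Icc_MVT a b (fun r => f r x) (fun r => ft r x) t s)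
    as [r [Hr mean_value]]; auto.
  assert (Dr : Icc a b r).
  { unfold Icc, Rmin, Rmax in *; repeat destruct Rle_dec; lra. }
  assert (rt : - delta < r - t < delta).
  { apply Rabs_lt_between in Hs.
    unfold Rmin, Rmax in Hr; repeat destruct Rle_dec; lra. }
  rewrite mean_value.
  replace (ft r x * (s - t) - (s - t) * ft t x)
    with ((ft r x - ft t x) * (s - t)) by ring.
  rewrite Rabs_mult. apply Rmult_le_compat_r; [apply Rabs_pos|]. apply Rlt_le.
  rewrite <- (clamp_id a b r Dr), <- (clamp_id a b t Dt) at 1.
  apply Hdelta; try lra. rewrite Rminus_diag, Rabs_R0. apply cond_pos.
Qed.

Lemma is_derive_on_RInt_param (a b c d : R) (f ft : R -> R -> R) (t : R) :
  is_partial_t_on (Icc a b) f ft -> jointly_continuous_on (Icc a b) ft ->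
  (forall s, Icc a b s -> ex_RInt (f s) c d) -> Icc a b t ->
  is_derive_on (Icc a b) (fun s => RInt (f s) c d) t (RInt (ft t) c d).
Proof.
  intros Hf Cft int_f Dt.
  assert (int_ft : ex_RInt (ft t) c d).
  { apply ex_RInt_everywhere_continuous. intros x.
    now apply (jointly_continuous_on_section (Icc a b)). }
  apply is_derive_on_eps_delta; [exact Dt|]. intros eps.
  assert (len_pos : 0 < Rabs (d - c) + 1)
    by (pose proof (Rabs_pos (d - c)); lra).
  set (eta := mkposreal _ (Rdiv_lt_0_compat _ _ (cond_pos eps) len_pos)).
  destruct (is_derive_on_Icc_uniform a b (Rmin c d) (Rmax c d) f ft t Hf Cft Dt
    eta) as [delta Hdelta].
  exists delta. intros s Ds Hs.
  assert (remainder : is_RInt (fun x => f s x - f t x - (s - t) * ft t x) c d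
    (RInt (f s) c d - RInt (f t) c d - (s - t) * RInt (ft t) c d)).
  { apply (is_RInt_minus (V := R_NormedModule)).
    - apply (is_RInt_minus (V := R_NormedModule));
        now apply (RInt_correct (V := R_CompleteNormedModule)), int_f.
    - apply (is_RInt_scal (V := R_NormedModule)).
      now apply (RInt_correct (V := R_CompleteNormedModule)). }
  apply Rle_trans with (Rabs (d - c) * (eta * Rabs (s - t))).
  - apply (norm_RInt_le_const_abs (V := R_NormedModule)) with (2 := remainder).
    intros x Hx. now apply Hdelta.
  - simpl. pose proof (cond_pos eps). pose proof (Rabs_pos (s - t)).
    replace (Rabs (d - c) * (eps / (Rabs (d - c) + 1) * Rabs (s - t)))
      with (Rabs (d - c) / (Rabs (d - c) + 1) * (eps * Rabs (s - t)))
      by (field; lra).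
    rewrite <- (Rmult_1_l (eps * Rabs (s - t))) at 2.
    apply Rmult_le_compat_r; [apply Rmult_le_pos; lra|].
    apply Rle_div_l; lra.
Qed.

(* Differentiate [f t y - f t 0 = RInt (fx t) 0 y] in time under the integral
   sign, then in [y]; unlike [Schwarz], this reaches the endpoints [a], [b]. *)
Lemma mixed_partials_on_Icc (a b : R) (f ft fx fxt : R -> R -> R) : a < b ->
  is_partial_t_on (Icc a b) f ft ->
  (forall t x, Icc a b t -> is_derive (f t) x (fx t x)) ->
  is_partial_t_on (Icc a b) fx fxt ->
  jointly_continuous_on (Icc a b) fx -> jointly_continuous_on (Icc a b) fxt ->
  forall t x, Icc a b t -> is_derive (ft t) x (fxt t x).
Proof.
  intros ab Hft Hfx Hfxt Cfx Cfxt t x Dt.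
  assert (cont_fx : forall s y, Icc a b s -> continuous (fx s) y).
  { intros s y Ds. now apply (jointly_continuous_on_section (Icc a b)). }
  assert (RInt_fxt : forall y, RInt (fxt t) 0 y = ft t y - ft t 0).
  { intros y.
    apply (is_derive_on_unique (Icc a b) (fun s => RInt (fx s) 0 y) t);
      [exact Dt|now apply Icc_adhDa| |].
    - apply is_derive_on_RInt_param; auto. intros s Ds.
      apply ex_RInt_everywhere_continuous. auto.
    - apply (is_derive_on_ext _ (fun s => f s y - f s 0)); [exact Dt| |].
      + intros s Ds. symmetry.
        apply (is_RInt_unique (V := R_CompleteNormedModule)).
        apply (is_RInt_derive (V := R_CompleteNormedModule)); auto.
      + apply is_derive_on_minus; auto. }
  apply (is_derive_ext (fun y => ft t 0 + RInt (fxt t) 0 y)).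
  { intros y. rewrite RInt_fxt. lra. }
  rewrite <- (Rplus_0_l (fxt t x)).
  apply (is_derive_plus (V := R_NormedModule)).
  - apply (is_derive_const (V := R_NormedModule)).
  - apply is_derive_RInt_everywhere_continuous. intros y.
    now apply (jointly_continuous_on_section (Icc a b)).
Qed.

Lemma Derive_periodic (f : R -> R) (p x : R) :
  (forall y, f (y + p) = f y) -> Derive f (x + p) = Derive f x.
Proof.
  intros Hp. unfold Derive. f_equal. apply Lim_ext. intros k.
  replace (x + p + k) with (x + k + p) by ring. now rewrite !Hp.
Qed.

Lemma Ck_strip_ext (T : R) (n : nat) (f g : R -> R -> R) :
  (forall t x, Icc 0 T t -> f t x = g t x) -> Ck_strip T n f -> Ck_strip T n g.
Proof.
  intros fg.
  destruct n as [|n]; intros [Cf Hf]; split;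
    try exact (continuous_on_ext _ _ _ (fun p => fg (fst p) (snd p)) Cf).
  - exact I.
  - destruct Hf as [ft [fx [Hft [Hfx Hn]]]].
    exists ft, fx. split; [|split; [|exact Hn]]; intros t x Dt.
    + apply (is_derive_on_ext _ (fun s => f s x)); auto.
    + apply (is_derive_ext (f t)); auto.
Qed.

Section SmoothOnTorus.

Variable T : R.
Hypothesis T_pos : 0 < T.

Lemma smooth_on_torus_continuous (f : R -> R -> R) :
  smooth_on_torus T f -> jointly_continuous_on (Icc 0 T) f.
Proof. intros [_ Hf]. exact (proj1 (Hf 0%nat)). Qed.

Lemma smooth_on_torus_continuous_space (f : R -> R -> R) (t x : R) :
  smooth_on_torus T f -> Icc 0 T t -> continuous (f t) x.
Proof.
  intros Hf.
  now apply jointly_continuous_on_section, smooth_on_torus_continuous.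
Qed.

Lemma smooth_on_torus_is_derive (f : R -> R -> R) (t x : R) :
  smooth_on_torus T f -> Icc 0 T t -> is_derive (f t) x (partial_x f t x).
Proof.
  intros [_ Hf] Dt. destruct (Hf 1%nat) as [_ [_ [fx [_ [Hfx _]]]]].
  apply Derive_correct. exists (fx t x). auto.
Qed.

Lemma smooth_on_torus_partial_x (f : R -> R -> R) :
  smooth_on_torus T f -> smooth_on_torus T (partial_x f).
Proof.
  intros [periodic_f Hf]. split.
  - intros t x Dt. apply Derive_periodic. auto.
  - intros n. destruct (Hf (S n)) as [_ [_ [fx [_ [Hfx [_ Cfx]]]]]].
    apply (Ck_strip_ext T n fx); [|exact Cfx].
    intros t x Dt. symmetry. apply is_derive_unique. auto.
Qed.

Lemma smooth_on_torus_partial_t (f ft : R -> R -> R) :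
  is_partial_t_on (Icc 0 T) f ft -> smooth_on_torus T f -> smooth_on_torus T ft.
Proof.
  intros Hft [periodic_f Hf].
  assert (unique_ft : forall t x l, Icc 0 T t ->
    is_derive_on (Icc 0 T) (fun s => f s x) t l -> l = ft t x).
  { intros t x l Dt Hl.
    apply (is_derive_on_unique (Icc 0 T) (fun s => f s x) t); auto.
    now apply Icc_adhDa. }
  split.
  - intros t x Dt. apply unique_ft; [exact Dt|].
    apply (is_derive_on_ext _ (fun s => f s (x + 2 * PI))); auto.
  - intros n. destruct (Hf (S n)) as [_ [gt [_ [Hgt [_ [Cgt _]]]]]].
    apply (Ck_strip_ext T n gt); auto.
Qed.

Lemma smooth_on_torus_partials_comm (f ft : R -> R -> R) :
  is_partial_t_on (Icc 0 T) f ft -> smooth_on_torus T f ->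
  is_partial_t_on (Icc 0 T) (partial_x f) (partial_x ft).
Proof.
  intros Hft Hf t x Dt.
  destruct (smooth_on_torus_partial_x f Hf) as [_ Hfx].
  destruct (Hfx 1%nat) as [Cfx [fxt [_ [Hfxt [_ [[Cfxt _] _]]]]]].
  replace (partial_x ft t x) with (fxt t x); [now apply Hfxt|].
  symmetry. apply is_derive_unique.
  apply (mixed_partials_on_Icc 0 T f ft (partial_x f)); auto.
  intros s y Ds. now apply smooth_on_torus_is_derive.
Qed.

End SmoothOnTorus.

Lemma is_derive_slope_flux (dphi G u v : R -> R) (x h ddphi ux vx : R) :
  is_derive u x ux -> is_derive v x vx -> v x = u x ^ 2 + h * ux ->
  is_derive dphi (u x) ddphi -> is_derive G (u x) (ddphi * u x ^ 2) ->
  is_derive (fun y => dphi (u y) * v y - G (u y)) x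
    (vx * dphi (u x) + h * ddphi * ux ^ 2).
Proof.
  intros Hu Hv v_eq Hdphi G_derive.
  replace (vx * dphi (u x) + h * ddphi * ux ^ 2)
    with ((ux * ddphi * v x + dphi (u x) * vx) - ux * (ddphi * u x ^ 2))
    by (rewrite v_eq; ring).
  apply (is_derive_minus (V := R_NormedModule)).
  - apply (is_derive_mult (fun y => dphi (u y)) v);
      [|exact Hv|exact Rmult_comm].
    now apply (is_derive_comp (V := R_NormedModule) dphi u).
  - now apply (is_derive_comp (V := R_NormedModule) G u).
Qed.

Lemma continuous_sqr (x : R) : continuous (fun y => y ^ 2) x.
Proof.
  apply (ex_derive_continuous (V := R_NormedModule)). now auto_derive.
Qed.

Definition slope_dissipation (ddphi h u ux : R -> R) (x : R) : R :=
  h x * ddphi (u x) * ux x ^ 2.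

Lemma continuous_slope_dissipation (ddphi h u ux : R -> R) (x : R) :
  continuous ddphi (u x) -> continuous h x -> continuous u x ->
  continuous ux x -> continuous (slope_dissipation ddphi h u ux) x.
Proof.
  intros Cddphi Ch Cu Cux. apply (continuous_mult (K := R_AbsRing)).
  - apply (continuous_mult (K := R_AbsRing)); [exact Ch|].
    now apply continuous_comp.
  - apply (continuous_comp ux (fun y => y ^ 2)); [exact Cux|].
    apply continuous_sqr.
Qed.

Lemma RInt_slope_production (dphi ddphi h u ux v vx : R -> R) (a b : R) :
  (forall w, is_derive dphi w (ddphi w)) -> (forall w, continuous ddphi w) ->
  (forall x, continuous h x) ->
  (forall x, is_derive u x (ux x)) -> (forall x, continuous ux x) ->
  (forall x, is_derive v x (vx x)) -> (forall x, continuous vx x) ->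
  (forall x, v x = u x ^ 2 + h x * ux x) ->
  u b = u a -> v b = v a ->
  RInt (fun x => vx x * dphi (u x)) a b =
  - RInt (slope_dissipation ddphi h u ux) a b.
Proof.
  intros Hdphi Cddphi Ch Hu Cux Hv Cvx v_eq ub vb.
  set (G := fun w => RInt (fun r => ddphi r * r ^ 2) 0 w).
  set (production := fun x => vx x * dphi (u x)).
  set (dissipation := slope_dissipation ddphi h u ux).
  assert (Cu : forall x, continuous u x).
  { intros x. exact (is_derive_continuous u x _ (Hu x)). }
  assert (Cproduction : forall x, continuous production x).
  { intros x. apply (continuous_mult (K := R_AbsRing)); [apply Cvx|].
    apply continuous_comp; [apply Cu|].
    exact (is_derive_continuous dphi _ _ (Hdphi (u x))). }
  assert (Cdissipation : forall x, continuous dissipation x).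
  { intros x. now apply continuous_slope_dissipation. }
  assert (G_derive : forall w, is_derive G w (ddphi w * w ^ 2)).
  { intros w.
    apply (is_derive_RInt_everywhere_continuous (fun r => ddphi r * r ^ 2)).
    intros r.
    apply (continuous_mult (K := R_AbsRing)); [auto|apply continuous_sqr]. }
  assert (balance : is_RInt (fun x => production x + dissipation x) a b 0).
  { replace 0 with ((dphi (u b) * v b - G (u b)) - (dphi (u a) * v a - G (u a)))
      by (rewrite ub, vb; ring).
    apply (is_RInt_derive (V := R_CompleteNormedModule)
      (fun y => dphi (u y) * v y - G (u y))); intros x _.
    - now apply is_derive_slope_flux.
    - now apply (continuous_plus (V := R_NormedModule)). }
  apply (is_RInt_unique (V := R_CompleteNormedModule)) in balance.
  rewrite (RInt_plus (V := R_CompleteNormedModule)) in balance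
    by now apply ex_RInt_everywhere_continuous.
  apply Rplus_opp_r_uniq. rewrite Rplus_comm. exact balance.
Qed.

Definition boussinesq_rhs (h : R -> R -> R) : R -> R -> R :=
  partial_x (fun t x => h t x * partial_x h t x).

Section SlopeEnergy.

Variables (T : R) (h : R -> R -> R).
Hypothesis T_pos : 0 < T.
Hypothesis h_smooth : smooth_on_torus T h.
Hypothesis h_sol : boussinesq_solution T h.

Lemma boussinesq_rhs_expand (t x : R) : Icc 0 T t ->
  boussinesq_rhs h t x =
  partial_x h t x ^ 2 + h t x * partial_x (partial_x h) t x.
Proof.
  intros Dt. apply is_derive_unique.
  replace (partial_x h t x ^ 2) with (partial_x h t x * partial_x h t x)
    by ring.
  apply (is_derive_mult (h t) (partial_x h t)); [| |exact Rmult_comm].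
  - now apply (smooth_on_torus_is_derive T).
  - apply (smooth_on_torus_is_derive T); [|exact Dt].
    now apply smooth_on_torus_partial_x.
Qed.

Lemma boussinesq_partial_t : is_partial_t_on (Icc 0 T) h (boussinesq_rhs h).
Proof.
  intros t x Dt. destruct (h_sol t x Dt) as [ht [Hht rhs_eq]].
  now replace (boussinesq_rhs h t x) with ht
    by exact (Rminus_diag_uniq _ _ rhs_eq).
Qed.

Lemma boussinesq_rhs_smooth : smooth_on_torus T (boussinesq_rhs h).
Proof.
  exact (smooth_on_torus_partial_t T T_pos h _ boussinesq_partial_t h_smooth).
Qed.

Variables phi dphi ddphi : R -> R.
Hypothesis phi_derive : forall w, is_derive phi w (dphi w).
Hypothesis dphi_derive : forall w, is_derive dphi w (ddphi w).
Hypothesis ddphi_continuous : forall w, continuous ddphi w.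

Lemma slope_energy_partial_t (t : R) : Icc 0 T t ->
  is_derive_on (Icc 0 T)
    (fun s => RInt (fun x => phi (partial_x h s x)) 0 (2 * PI)) t
    (RInt (fun x => partial_x (boussinesq_rhs h) t x * dphi (partial_x h t x))
      0 (2 * PI)).
Proof.
  intros Dt. pose proof (smooth_on_torus_partial_x T h h_smooth) as u_smooth.
  apply (is_derive_on_RInt_param 0 T 0 (2 * PI)
    (fun s x => phi (partial_x h s x))
    (fun s x => partial_x (boussinesq_rhs h) s x * dphi (partial_x h s x)));
    [| | |exact Dt].
  - intros s x Ds.
    apply (is_derive_on_comp _ phi (fun r => partial_x h r x));
      [exact Ds|auto|].
    apply smooth_on_torus_partials_comm; auto. exact boussinesq_partial_t.
  - apply jointly_continuous_on_mult.
    + apply smooth_on_torus_continuous, smooth_on_torus_partial_x.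
      exact boussinesq_rhs_smooth.
    + apply jointly_continuous_on_comp; [|now apply smooth_on_torus_continuous].
      intros w. exact (is_derive_continuous dphi w _ (dphi_derive w)).
  - intros s Ds. apply ex_RInt_everywhere_continuous. intros x.
    apply continuous_comp; [now apply (smooth_on_torus_continuous_space T)|].
    exact (is_derive_continuous phi _ _ (phi_derive _)).
Qed.

Lemma slope_energy_dissipation (t : R) : Icc 0 T t ->
  is_derive_on (Icc 0 T)
    (fun s => RInt (fun x => phi (partial_x h s x)) 0 (2 * PI)) t
    (- RInt (slope_dissipation ddphi (h t) (partial_x h t)
        (partial_x (partial_x h) t)) 0 (2 * PI)).
Proof.
  intros Dt. pose proof (smooth_on_torus_partial_x T h h_smooth) as u_smooth.
  pose proof (smooth_on_torus_partial_x T _ u_smooth) as ux_smooth.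
  pose proof boussinesq_rhs_smooth as v_smooth.
  pose proof (smooth_on_torus_partial_x T _ v_smooth) as vx_smooth.
  rewrite <- (RInt_slope_production dphi ddphi (h t) (partial_x h t)
    (partial_x (partial_x h) t) (boussinesq_rhs h t)
    (partial_x (boussinesq_rhs h) t)); auto.
  - now apply slope_energy_partial_t.
  - intros x. now apply (smooth_on_torus_continuous_space T).
  - intros x. now apply (smooth_on_torus_is_derive T).
  - intros x. now apply (smooth_on_torus_continuous_space T).
  - intros x. now apply (smooth_on_torus_is_derive T).
  - intros x. now apply (smooth_on_torus_continuous_space T).
  - intros x. now apply boussinesq_rhs_expand.
  - rewrite <- (Rplus_0_l (2 * PI)). now apply (proj1 u_smooth).
  - rewrite <- (Rplus_0_l (2 * PI)). now apply (proj1 v_smooth).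
Qed.

Lemma RInt_slope_dissipation_nonneg (t : R) :
  (forall w, 0 <= ddphi w) -> (forall x, 0 <= h t x) -> Icc 0 T t ->
  0 <= RInt (slope_dissipation ddphi (h t) (partial_x h t)
        (partial_x (partial_x h) t)) 0 (2 * PI).
Proof.
  intros phi_convex h_nonneg Dt.
  pose proof (smooth_on_torus_partial_x T h h_smooth) as u_smooth.
  pose proof (smooth_on_torus_partial_x T _ u_smooth) as ux_smooth.
  pose proof PI_RGT_0. apply RInt_ge_0; [lra| |].
  - apply ex_RInt_everywhere_continuous. intros x.
    apply continuous_slope_dissipation;
      [auto|now apply (smooth_on_torus_continuous_space T)..].
  - intros x _. apply Rmult_le_pos; [|apply pow2_ge_0].
    now apply Rmult_le_pos.
Qed.

End SlopeEnergy.

Lemma is_derive_xatan (u : R) :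
  is_derive (fun v => v * atan v) u (atan u + u / (1 + u ^ 2)).
Proof.
  pose proof (plus_Rsqr_gt_0 u).
  auto_derive; [exact I|]. unfold Rsqr. field. lra.
Qed.

Definition d2_xatan (u : R) : R := 2 / (1 + u ^ 2) ^ 2.

Lemma is_derive2_xatan (u : R) :
  is_derive (fun v => atan v + v / (1 + v ^ 2)) u (d2_xatan u).
Proof.
  pose proof (plus_Rsqr_gt_0 u). unfold d2_xatan.
  auto_derive; [lra|]. unfold Rsqr. field. lra.
Qed.

Lemma d2_xatan_pos (u : R) : 0 < d2_xatan u.
Proof.
  apply Rdiv_lt_0_compat; [lra|]. apply pow_lt, plus_Rsqr_gt_0.
Qed.

Lemma continuous_d2_xatan (u : R) : continuous d2_xatan u.
Proof.
  pose proof (plus_Rsqr_gt_0 u).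
  apply (ex_derive_continuous (V := R_NormedModule)).
  unfold d2_xatan. auto_derive. nra.
Qed.

Theorem propositionB3 (T : R) (h : R -> R -> R)
  (hT : 0 < T)
  (hsmooth : smooth_on_torus T h)
  (hpos : forall t x, Icc 0 T t -> 0 < h t x)
  (hsol : boussinesq_solution T h) :
  forall t, Icc 0 T t ->
    exists l : R,
      is_derive_on (Icc 0 T)
        (fun s => RInt (fun x => partial_x h s x * atan (partial_x h s x)) 0 (2 * PI)) t l /\
      l <= 0.
Proof.
  intros t Dt. eexists. split.
  - exact (slope_energy_dissipation T h hT hsmooth hsol _ _ d2_xatan
      is_derive_xatan is_derive2_xatan continuous_d2_xatan t Dt).
  - apply Ropp_le_cancel. rewrite Ropp_0, Ropp_involutive.
    apply (RInt_slope_dissipation_nonneg T); auto.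
    + exact continuous_d2_xatan.
    + intros w. apply Rlt_le, d2_xatan_pos.
    + intros x. now apply Rlt_le, hpos.
Qed.
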